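(* Let $\min\{\mathbf{c}^{\top}x : \mathbf{A}x=\mathbf{b},\ x\ge 0\}$ be a type (A) interval linear program, with $\mathbf{A}=[\underline A,\overline A]\subseteq\mathbb{R}^{m\times n}$, $\mathbf{b}=[\underline b,\overline b]\subseteq\mathbb{R}^m$, $\mathbf{c}=[\underline c,\overline c]\subseteq\mathbb{R}^n$. Then $$\overline f(\mathbf{A},\mathbf{b},\mathbf{c})=\max\Bigl\{\max_{b\in\mathbf{b}} b^{\top}y \;:\; y\in\mathbb{R}^m,\ \exists A\in\mathbf{A}\ \exists c\in\mathbf{c}:\ A^{\top}y\le c\Bigr\}$$ if and only if the interval linear program satisfies at least one of the conditions: (i) it has strongly zero duality gap; (ii) $\overline g(\mathbf{A},\mathbf{b},\mathbf{c})=\infty$, i.e., the dual interval linear program has an unbounded scenario.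
   Context: For real matrices $\underline{A}\le\overline{A}$ (entrywise), $\mathbf{A}=[\underline{A},\overline{A}]=\{A:\underline{A}\le A\le\overline{A}\}$; interval vectors are defined analogously. The type (A) interval linear program is the family of linear programs $\min\{c^{\top}x: Ax=b,\ x\ge 0\}$ over all scenarios $(A,b,c)$ with $A\in\mathbf{A}$, $b\in\mathbf{b}$, $c\in\mathbf{c}$. The dual interval linear program is the family of the duals $\max\{b^{\top}y: A^{\top}y\le c\}$ of these scenarios. For a scenario, $f(A,b,c)\in\mathbb{R}\cup\{\pm\infty\}$ is the primal optimal value ($+\infty$ if infeasible, $-\infty$ if unbounded) and $g(A,b,c)\in\mathbb{R}\cup\{\pm\infty\}$ is the dual optimal value ($-\infty$ if infeasible, $+\infty$ if unbounded). Set $$\overline f(\mathbf{A},\mathbf{b},\mathbf{c})=\sup\{f(A,b,c):A\in\mathbf{A},b\in\mathbf{b},c\in\mathbf{c}\},\qquad \overline g(\mathbf{A},\mathbf{b},\mathbf{c})=\sup\{g(A,b,c):A\in\mathbf{A},b\in\mathbf{b},c\in\mathbf{c}\}.$$ Maxima are taken on the extended real axis: the maximum of a set is its supremum in $\mathbb{R}\cup\{\pm\infty\}$, with $\max\emptyset=-\infty$ and value $\infty$ if the set is unbounded above. A scenario has zero duality gap if and only if at least one of its primal and dual linear programs is feasible (otherwise the duality gap is $\infty$). The duality gap of the interval linear program is strongly zero if all scenarios have zero duality gap. *)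

(* Defs.v *)
From mathcomp Require Import all_boot all_order all_algebra.
From mathcomp Require Import boolp classical_sets reals constructive_ereal ereal.

Set Implicit Arguments.
Unset Strict Implicit.
Unset Printing Implicit Defensive.

Import Order.TTheory GRing.Theory Num.Theory.
Local Open Scope classical_set_scope.
Local Open Scope ring_scope.

Definition mxle (R : realType) (p q : nat) (A B : 'M[R]_(p, q)) : Prop :=
  forall i j, A i j <= B i j.

(* Interval matrix; an interval (column) vector is the case q = 1. *)
Definition itvmx (R : realType) (p q : nat) (L U : 'M[R]_(p, q)) :
    set 'M[R]_(p, q) :=
  [set A | mxle L A /\ mxle A U].

Definition dotv (R : realType) (p : nat) (u v : 'cV[R]_p) : R :=
  (u^T *m v) 0 0.

Section Scenario.
Variables (R : realType) (m n : nat).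
Implicit Types (A : 'M[R]_(m, n)) (b : 'cV[R]_m) (c : 'cV[R]_n).

Definition primal_feasible A b : set 'cV[R]_n :=
  [set x | A *m x = b /\ mxle 0 x].

Definition dual_feasible A c : set 'cV[R]_m :=
  [set y | mxle (A^T *m y) c].

(* Optimal values; since inf set0 = +oo and sup set0 = -oo, infeasibility gets
   the conventional value. *)
Definition primal_value A b c : \bar R :=
  ereal_inf [set (dotv c x)%:E | x in primal_feasible A b].

Definition dual_value A b c : \bar R :=
  ereal_sup [set (dotv b y)%:E | y in dual_feasible A c].

Definition dual_unbounded A b c : Prop :=
  forall M : R, exists2 y, dual_feasible A c y & M < dotv b y.

(* By convention the gap is 0 as soon as one of the two programs is feasible,
   and infinite when both are infeasible. *)
Definition zero_duality_gap A b c : Prop :=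
  primal_feasible A b !=set0 \/ dual_feasible A c !=set0.

End Scenario.

Section IntervalLP.
Variables (R : realType) (m n : nat).
Variables (AA : set 'M[R]_(m, n)) (bb : set 'cV[R]_m) (cc : set 'cV[R]_n).

Definition sup_primal_value : \bar R :=
  ereal_sup [set v | exists A b c,
    [/\ AA A, bb b, cc c & v = primal_value A b c]].

Definition sup_dual_value : \bar R :=
  ereal_sup [set v | exists A b c,
    [/\ AA A, bb b, cc c & v = dual_value A b c]].

Definition strongly_zero_duality_gap : Prop :=
  forall A b c, AA A -> bb b -> cc c -> zero_duality_gap A b c.

Definition has_unbounded_dual_scenario : Prop :=
  exists A b c, [/\ AA A, bb b, cc c & dual_unbounded A b c].

Definition weakly_dual_feasible : set 'cV[R]_m :=
  [set y | exists A c, [/\ AA A, cc c & dual_feasible A c y]].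

(* max { max_{b in bb} b^T y : y weakly dual feasible }, both maxima being
   suprema in the extended reals. *)
Definition max_weakly_dual : \bar R :=
  ereal_sup [set ereal_sup [set (dotv b y)%:E | b in bb]
            | y in weakly_dual_feasible].

End IntervalLP.

(* Main.v *)
Require Import Defs.
From mathcomp Require Import all_boot all_order all_algebra.
From mathcomp Require Import boolp classical_sets reals constructive_ereal ereal.
From mathcomp Require Import lra.

Import Order.TTheory GRing.Theory Num.Theory.

Local Open Scope classical_set_scope.
Local Open Scope ring_scope.

(** The right-hand side of the first equivalence is the best dual value
    [sup_dual_value] in disguise: both are the supremum of [b^T y] over all
    scenarios and all dual feasible [y], taken in a different order
    ([max_weakly_dualE]).  The question is therefore when the best primal value
    and the best dual value agree.  In each scenario the dual value is at most
    the primal value ([weak_duality]), with equality as soon as one of the two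
    programs is feasible ([strong_duality]); hence a strongly zero gap makes
    the suprema equal, and so does an infinite dual supremum.  Conversely, a
    scenario in which both programs are infeasible has primal value [+oo], so
    equality of the suprema then forces the dual supremum to be [+oo].

    Strong duality comes from Farkas' lemma ([farkas]), applied to the primal
    system extended by the constraint that the objective is at most [t], for a
    hypothetical [t] strictly inside the gap ([gap_certificate]).

    That an infinite dual supremum is caused by a single scenario with unbounded
    dual is a finiteness argument.  For a fixed sign pattern of [y], one vertex
    scenario simultaneously relaxes the constraints [A^T y <= c] and increases
    [b^T y] as much as possible.  So every value reached in some scenario is
    dominated in one of the [2 ^ m] vertex scenarios, and if the duals of all
    of these were bounded, the whole family would be. *)

(** * Linear programming duality *)

Lemma dotvC (R : realType) (p : nat) (u v : 'cV[R]_p) : dotv u v = dotv v u.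
Proof. by rewrite /dotv -[u^T *m v]trmxK trmx_mul trmxK mxE. Qed.

Lemma dotvDr (R : realType) (p : nat) (u v w : 'cV[R]_p) :
  dotv u (v + w) = dotv u v + dotv u w.
Proof. by rewrite /dotv mulmxDr mxE. Qed.

Lemma dotvZr (R : realType) (p : nat) (k : R) (u v : 'cV[R]_p) :
  dotv u (k *: v) = k * dotv u v.
Proof. by rewrite /dotv -scalemxAr mxE. Qed.

Lemma dotv_mulmx (R : realType) (p q : nat) (A : 'M[R]_(p, q)) u v :
  dotv (A *m u) v = dotv u (A^T *m v).
Proof. by rewrite /dotv trmx_mul mulmxA. Qed.

Lemma ler_dotv2l {R : realType} {p : nat} {u v w : 'cV[R]_p} :
  mxle 0 u -> mxle v w -> dotv u v <= dotv u w.
Proof.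
move=> u0 vw; rewrite /dotv !mxE; apply: ler_sum => i _; rewrite mxE.
by apply: ler_wpM2l => //; have := u0 i 0; rewrite mxE.
Qed.

(** Farkas' lemma, by Bartl's induction on the number of generators of the cone.
    If the generators in [B] alone do not satisfy the hypothesis, some [y0] is
    nonpositive on [B] and positive on [b], hence positive on the new generator
    [a]; it is normalised so that [a^T y0 = 1].  Projecting along [a] onto the
    hyperplane orthogonal to [y0] eliminates [a], and the coefficient of [a]
    that is recovered afterwards is nonnegative by the signs of [y0]. *)
Lemma farkas (R : realType) (m n : nat) (A : 'M[R]_(m, n)) (b : 'cV[R]_m) :
  (forall y : 'cV[R]_m, mxle (A^T *m y) 0 -> dotv b y <= 0) ->
  primal_feasible A b !=set0.
Proof.
elim: n A b => [|n IHn] A b Hb.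
  exists 0; split; last by move=> i j.
  have : dotv b b <= 0 by apply: Hb => -[].
  rewrite /dotv mxE => bb_le0.
  have sq_ge0 (i : 'I_m) : true -> 0 <= b^T 0 i * b i 0.
    by rewrite mxE -expr2 sqr_ge0.
  have bb0 : \sum_i b^T 0 i * b i 0 = 0.
    by apply/eqP; rewrite eq_le bb_le0 sumr_ge0.
  rewrite mulmx0; apply/matrixP => i j; rewrite ord1 [LHS]mxE; apply/esym/eqP.
  move/eqP: bb0; rewrite psumr_eq0 // => /allP /(_ i (mem_index_enum _)) /=.
  by rewrite mxE mulf_eq0 orbb.
rewrite -[n.+1]/(1 + n)%N in A Hb *.
rewrite -[A]hsubmxK in Hb *; move: (lsubmx A) (rsubmx A) Hb => a B Hb.
have {}Hb y : dotv a y <= 0 -> mxle (B^T *m y) 0 -> dotv b y <= 0.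
  move=> ay By; apply: Hb => i j; rewrite tr_row_mx mul_col_mx.
  rewrite !ord1 [leRHS]mxE; case: (split_ordP i) => k ->.
    by rewrite col_mxEu !ord1.
  by rewrite col_mxEd; have := By k 0; rewrite [leRHS]mxE.
have [HB|] := pselect (forall y, mxle (B^T *m y) 0 -> dotv b y <= 0).
  have [x [Bx x0]] := IHn B b HB.
  exists (col_mx 0 x); split; first by rewrite mul_row_col mulmx0 add0r.
  move=> i j; case: (split_ordP i) => k ->; rewrite ?col_mxEu ?col_mxEd !mxE //.
  by have := x0 k j; rewrite mxE.
move=> /existsNP [y1 /not_implyP [By1 /negP]]; rewrite -ltNge => by1.
have ay1 : 0 < dotv a y1.
  by rewrite ltNge; apply/negP => ay1; have := Hb _ ay1 By1; rewrite leNgt by1.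
pose y0 := (dotv a y1)^-1 *: y1.
have ay0 : dotv a y0 = 1 by rewrite dotvZr mulVf // gt_eqF.
have by0 : 0 < dotv b y0 by rewrite dotvZr mulr_gt0 ?invr_gt0.
have By0 : mxle (B^T *m y0) 0.
  move=> i j; rewrite -scalemxAr [leLHS]mxE [leRHS]mxE.
  rewrite mulr_ge0_le0 ?invr_ge0 ?(ltW ay1) //.
  by have := By1 i j; rewrite [leRHS]mxE.
pose P := 1%:M - a *m y0^T.
have Pa : P *m a = 0.
  rewrite mulmxBl mul1mx -mulmxA.
  have -> : y0^T *m a = 1%:M.
    by apply/matrixP => i j; rewrite !ord1 -[LHS]/(dotv y0 a) dotvC ay0 mxE.
  by rewrite mulmx1 subrr.
have [x [PBx x0]] : primal_feasible (P *m B) (P *m b) !=set0.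
  apply: IHn => y; rewrite trmx_mul -mulmxA dotv_mulmx => BPy.
  apply: Hb => //; rewrite -dotv_mulmx Pa.
  by rewrite /dotv trmx0 mul0mx mxE.
exists (col_mx (y0^T *m (b - B *m x)) x); split.
  rewrite mul_row_col; move: PBx; rewrite /P -mulmxA !mulmxBl !mul1mx => PBx.
  rewrite mulmxA mulmxBr -[RHS](subrK (a *m y0^T *m b)) -PBx.
  by rewrite addrC addrAC addrA.
move=> i j; case: (split_ordP i) => k ->; rewrite ?col_mxEu ?col_mxEd !ord1.
  rewrite -[leRHS]/(dotv y0 (b - B *m x)) -scaleN1r dotvDr dotvZr mxE.
  rewrite [dotv y0 (B *m x)]dotvC dotv_mulmx [dotv y0 b]dotvC.
  have := ler_dotv2l x0 By0; rewrite {2}/dotv mulmx0 [X in _ <= X]mxE; lra.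
by have := x0 k 0; rewrite !mxE.
Qed.

Lemma weak_duality (R : realType) (m n : nat) (A : 'M[R]_(m, n)) b c :
  (dual_value A b c <= primal_value A b c)%E.
Proof.
apply: ge_ereal_sup => _ [y yA <-]; apply: le_ereal_inf_tmp => _ [x [<- x0] <-].
by rewrite lee_fin dotv_mulmx [dotv c x]dotvC ler_dotv2l.
Qed.

(** Farkas' lemma for [A x = b], [c^T x + s = t], [x >= 0], [s >= 0], where
    [s] is the slack of the objective bound.  The multiplier of the bound is
    [- lam]; [lam = 0] means that [y] already refutes [A x = b], [x >= 0]. *)
Lemma gap_certificate {R : realType} {m n : nat} {A : 'M[R]_(m, n)} {b c} {t : R} :
  (forall x, primal_feasible A b x -> t < dotv c x) ->
  exists y lam, [/\ 0 <= lam, mxle (A^T *m y) (lam *: c) & lam * t < dotv b y].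
Proof.
move=> Ht.
pose A' : 'M[R]_(m + 1, n + 1) := block_mx A 0 c^T 1%:M.
pose b' : 'cV[R]_(m + 1) := col_mx b t%:M.
have [Hf|] := pselect (forall y, mxle (A'^T *m y) 0 -> dotv b' y <= 0).
  have [x [Ax x0]] := @farkas R _ _ A' b' Hf.
  move: Ax x0; rewrite -[x]vsubmxK; move: (usubmx x) (dsubmx x) => u s.
  rewrite mul_block_col mul0mx addr0 mul1mx => /eq_col_mx [Au cu] us0.
  have u0 : mxle 0 u.
    by move=> i j; have := us0 (lshift 1 i) j; rewrite col_mxEu !mxE.
  have s0 : 0 <= s 0 0.
    by have := us0 (rshift n 0) 0; rewrite col_mxEd !mxE.
  have := Ht u (conj Au u0); move/matrixP: cu => /(_ 0 0).
  by rewrite mxE -[(c^T *m u) 0 0]/(dotv c u) mxE eqxx mulr1n; lra.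
move=> /existsNP [z /not_implyP []].
rewrite -[z]vsubmxK; move: (usubmx z) (dsubmx z) => y l.
rewrite /A' /b' tr_block_mx mul_block_col /dotv tr_col_mx mul_row_col.
rewrite trmxK trmx0 mul0mx add0r trmx1 mul1mx tr_scalar_mx mul_scalar_mx.
rewrite [l]mx11_scalar; move: (l 0 0) => {}l Hle /negP; rewrite -ltNge.
rewrite [ltRHS]mxE [X in _ + X]mxE [X in _ + _ * X]mxE eqxx mulr1n => Hlt.
exists y, (- l); split.
- have := Hle (rshift n 0) 0; rewrite col_mxEd !mxE eqxx mulr1n; lra.
- move=> i j; have := Hle (lshift 1 i) j; rewrite ord1 col_mxEu.
  rewrite mul_mx_scalar [leLHS]mxE [X in _ + X]mxE [X in _ <= X -> _]mxE.
  rewrite [X in _ -> _ <= X]mxE; lra.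
- by move: Hlt; rewrite -[(b^T *m y) 0 0]/(dotv b y); lra.
Qed.

Lemma ereal_lt_between (R : realType) (x z : \bar R) :
  (x < z)%E -> exists2 t : R, (x < t%:E)%E & (t%:E < z)%E.
Proof.
case: x z => [x||] [z||] //.
- by rewrite lte_fin => xz; exists ((x + z) / 2); rewrite lte_fin; lra.
- by exists (x + 1); rewrite ?ltry // lte_fin; lra.
- by exists (z - 1); rewrite ?ltNyr // lte_fin; lra.
- by exists 0; rewrite ?ltNyr ?ltry.
Qed.

Lemma strong_duality (R : realType) (m n : nat) (A : 'M[R]_(m, n)) b c :
  zero_duality_gap A b c -> primal_value A b c = dual_value A b c.
Proof.
move=> gap0; apply/eqP; rewrite eq_le weak_duality andbT leNgt; apply/negP.
move=> /ereal_lt_between [t gt tf].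
have dual_le y : dual_feasible A c y -> dotv b y < t.
  move=> yA; rewrite -lte_fin; apply: le_lt_trans gt.
  by apply: ereal_sup_ubound; exists y.
have [x xA|y [lam [lam0 Ay bty]]] := @gap_certificate R m n A b c t.
  rewrite -lte_fin; apply: (lt_le_trans tf).
  by apply: ereal_inf_lbound; exists x.
have [lam_gt0|] := ltP 0 lam.
  suff /dual_le : dual_feasible A c (lam^-1 *: y).
    by rewrite dotvZr ltNge ler_pdivlMl // ltW.
  move=> i j; rewrite -scalemxAr [leLHS]mxE ler_pdivrMl //.
  by have := Ay i j; rewrite [leRHS]mxE.
move=> lam_le0; have {lam0 lam_le0} lam0 : lam = 0 by lra.
move: Ay bty; rewrite lam0 scale0r mul0r => Ay by_gt0.
case: gap0 => [[x [Axb x0]]|[y0 y0A]].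
  have := ler_dotv2l x0 Ay.
  by rewrite -dotv_mulmx Axb {2}/dotv mulmx0 [leRHS]mxE leNgt by_gt0.
(* The multiple of the ray [y] is chosen to bring the value up to [t]. *)
pose k := (t - dotv b y0) / dotv b y.
have k0 : 0 <= k.
  by rewrite divr_ge0 // ?ltW // subr_gt0; exact: dual_le.
suff /dual_le : dual_feasible A c (y0 + k *: y).
  by rewrite dotvDr dotvZr divfK ?gt_eqF // subrKC ltxx.
move=> i j; rewrite mulmxDr -scalemxAr mxE [X in _ + X]mxE.
rewrite -[leRHS]addr0 lerD //.
by rewrite mulr_ge0_le0 //; have := Ay i j; rewrite [leRHS]mxE.
Qed.

(** * Suprema over the scenarios *)

Lemma max_weakly_dualE (R : realType) (m n : nat)
    (AA : set 'M[R]_(m, n)) (bb : set 'cV[R]_m) (cc : set 'cV[R]_n) :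
  max_weakly_dual AA bb cc = sup_dual_value AA bb cc.
Proof.
apply/eqP; rewrite eq_le; apply/andP; split.
  apply: ge_ereal_sup => _ [y [A [c [AAA ccc yA]]] <-].
  apply: ge_ereal_sup => _ [b bbb <-].
  apply: le_ereal_sup_tmp; exists (dual_value A b c); first by exists A, b, c.
  by apply: ereal_sup_ubound; exists y.
apply: ge_ereal_sup => _ [A [b [c [AAA bbb ccc ->]]]].
apply: ge_ereal_sup => _ [y yA <-].
apply: le_ereal_sup_tmp.
exists (ereal_sup [set (dotv b y)%:E | b in bb]).
  by exists y => //; exists A, c.
by apply: ereal_sup_ubound; exists b.
Qed.

Lemma sup_dual_le_primal (R : realType) (m n : nat)
    (AA : set 'M[R]_(m, n)) (bb : set 'cV[R]_m) (cc : set 'cV[R]_n) :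
  (sup_dual_value AA bb cc <= sup_primal_value AA bb cc)%E.
Proof.
apply: ge_ereal_sup => _ [A [b [c [AAA bbb ccc ->]]]].
apply: le_ereal_sup_tmp; exists (primal_value A b c); last exact: weak_duality.
by exists A, b, c.
Qed.

Lemma sup_primal_eq_dual (R : realType) (m n : nat)
    (AA : set 'M[R]_(m, n)) (bb : set 'cV[R]_m) (cc : set 'cV[R]_n) :
  sup_primal_value AA bb cc = sup_dual_value AA bb cc <->
  strongly_zero_duality_gap AA bb cc \/ sup_dual_value AA bb cc = +oo%E.
Proof.
split=> [fg|[gap0|goo]].
- have [|] := pselect (strongly_zero_duality_gap AA bb cc); first by left.
  move=> gap; right; apply/eqP; rewrite -leye_eq leNgt; apply/negP => goo.
  apply: gap => A b c AAA bbb ccc.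
  have [|pinf] := pselect (primal_feasible A b !=set0); first by left.
  exfalso; move: goo; rewrite -fg ltNge => /negP; apply.
  apply: ereal_sup_ubound; exists A, b, c; split=> //.
  apply/esym; rewrite /primal_value.
  suff -> : primal_feasible A b = set0 by rewrite image_set0 ereal_inf0.
  by apply/eqP/negPn/negP => /set0P.
- rewrite /sup_primal_value /sup_dual_value; congr ereal_sup.
  apply/seteqP; split=> v [A [b [c [AAA bbb ccc ->]]]]; exists A, b, c;
    by split=> //; rewrite strong_duality //; exact: gap0.
- by rewrite goo; apply/eqP; rewrite -leye_eq -goo sup_dual_le_primal.
Qed.

(** * Vertex scenarios *)

(** With [s] the sign pattern of [y], this vertex of the interval matrix
    maximises every entry of [B^T y] over [L <= B <= U]; with [L] and [U]
    exchanged, it minimises them. *)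
Definition vertex_mx {R : realType} {m q : nat} (s : {ffun 'I_m -> bool})
    (L U : 'M[R]_(m, q)) : 'M[R]_(m, q) :=
  \matrix_(i, j) if s i then U i j else L i j.

Definition sign_pattern {R : realType} {m : nat} (y : 'cV[R]_m) :
    {ffun 'I_m -> bool} := [ffun i => 0 <= y i 0].

Lemma vertex_mx_itv {R : realType} {m q : nat} (s : {ffun 'I_m -> bool})
    {L U : 'M[R]_(m, q)} :
  mxle L U -> itvmx L U (vertex_mx s L U) /\ itvmx L U (vertex_mx s U L).
Proof. by move=> LU; do 2 split; move=> i j; rewrite mxE; case: (s i). Qed.

Lemma vertex_mx_max {R : realType} {m q : nat} {L U B : 'M[R]_(m, q)}
    (y : 'cV[R]_m) :
  itvmx L U B -> mxle (B^T *m y) ((vertex_mx (sign_pattern y) L U)^T *m y).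
Proof.
move=> [LB BU] i j; rewrite ord1 !mxE; apply: ler_sum => k _.
rewrite !mxE ffunE; have [y0|/ltW y0] := leP 0 (y k 0).
  by rewrite ler_wpM2r.
by rewrite ler_wnM2r.
Qed.

Lemma vertex_mx_min {R : realType} {m q : nat} {L U B : 'M[R]_(m, q)}
    (y : 'cV[R]_m) :
  itvmx L U B -> mxle ((vertex_mx (sign_pattern y) U L)^T *m y) (B^T *m y).
Proof.
move=> [LB BU] i j; rewrite ord1 !mxE; apply: ler_sum => k _.
rewrite !mxE ffunE; have [y0|/ltW y0] := leP 0 (y k 0).
  by rewrite ler_wpM2r.
by rewrite ler_wnM2r.
Qed.

(** If every vertex scenario [s] had a bounded dual, with bound [M s], the
    maximum of the [M s] would bound the dual values of all scenarios. *)
Lemma sup_dual_infinite (R : realType) (m n : nat)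
    (Al Au : 'M[R]_(m, n)) (bl bu : 'cV[R]_m) (cl cu : 'cV[R]_n) :
  mxle Al Au -> mxle bl bu -> mxle cl cu ->
  sup_dual_value (itvmx Al Au) (itvmx bl bu) (itvmx cl cu) = +oo%E <->
  has_unbounded_dual_scenario (itvmx Al Au) (itvmx bl bu) (itvmx cl cu).
Proof.
move=> hA hb hc; split=> [goo|[A [b [c [AAA bbb ccc unb]]]]]; last first.
  apply/eqP; rewrite -leye_eq; apply: le_ereal_sup_tmp.
  exists (dual_value A b c); first by exists A, b, c.
  rewrite leNgt; apply/negP => /ereal_lt_between [M gM _].
  have [y yA My] := unb M.
  suff : (M%:E < M%:E)%E by rewrite ltxx.
  apply: lt_trans gM; rewrite -lte_fin in My; apply: (lt_le_trans My).
  by apply: ereal_sup_ubound; exists y.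
apply: contrapT => bounded.
have /choice [M HM] (s : {ffun 'I_m -> bool}) : exists M : R, forall y,
    dual_feasible (vertex_mx s Au Al) cu y -> dotv (vertex_mx s bl bu) y <= M.
  apply: contrapT => unb; apply: bounded.
  exists (vertex_mx s Au Al), (vertex_mx s bl bu), cu; split.
  - exact: (vertex_mx_itv s hA).2.
  - exact: (vertex_mx_itv s hb).1.
  - by split=> // i j.
  move=> M; apply: contrapT => unbM; apply: unb; exists M => y yA.
  by rewrite leNgt; apply/negP => My; apply: unbM; exists y.
suff : (sup_dual_value (itvmx Al Au) (itvmx bl bu) (itvmx cl cu)
        <= (\big[Num.max/0]_s M s)%:E)%E by rewrite goo.
apply: ge_ereal_sup => _ [A [b [c [AAA bbb [_ ccu] ->]]]].
apply: ge_ereal_sup => _ [y yA <-]; rewrite lee_fin.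
apply: le_trans (vertex_mx_max y bbb 0 0) _.
apply: le_trans (le_bigmax _ _ (sign_pattern y)); apply: HM => i j.
exact: le_trans (vertex_mx_min y AAA i j) (le_trans (yA i j) (ccu i j)).
Qed.

Theorem theorem8 (R : realType) (m n : nat)
    (Al Au : 'M[R]_(m, n)) (bl bu : 'cV[R]_m) (cl cu : 'cV[R]_n)
    (hA : mxle Al Au) (hb : mxle bl bu) (hc : mxle cl cu) :
  (sup_primal_value (itvmx Al Au) (itvmx bl bu) (itvmx cl cu)
     = max_weakly_dual (itvmx Al Au) (itvmx bl bu) (itvmx cl cu)
   <->
   strongly_zero_duality_gap (itvmx Al Au) (itvmx bl bu) (itvmx cl cu)
   \/ sup_dual_value (itvmx Al Au) (itvmx bl bu) (itvmx cl cu) = +oo%E)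
  /\
  (sup_dual_value (itvmx Al Au) (itvmx bl bu) (itvmx cl cu) = +oo%E
   <-> has_unbounded_dual_scenario (itvmx Al Au) (itvmx bl bu) (itvmx cl cu)).
Proof.
rewrite max_weakly_dualE; split; first exact: sup_primal_eq_dual.
exact: sup_dual_infinite.
Qed.
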